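(* (i) For every fixed $n\in\mathbb{N}$ and every fixed subgroup $B\le\mathcal{S}_n$, the set $\{\delta(A\wr_P B)\mid A\le\mathcal{S}_m\text{ primitive},\ m\in\mathbb{N}\}$ is dense in the interval $[0,1]$. (ii) For every fixed $m\in\mathbb{N}$ and every fixed subgroup $A\le\mathcal{S}_m$, the set $\{\delta(A\wr_P B)\mid B\le\mathcal{S}_n\text{ regular},\ n\in\mathbb{N}\}$ is dense in the interval $[\delta(A),1]$.
   Context: $\mathbb{N}$ is the set of positive integers; $\mathcal{S}_n$ is the symmetric group on $[n]=\{1,\dots,n\}$; permutations act on the right, $x\mapsto xg$. For a finite group $G$ acting on a finite set $X$, $\delta(G)=\delta(G,X)$ is the proportion of elements of $G$ with no fixed point in $X$; subgroups of $\mathcal{S}_n$ act naturally on $[n]$. Primitive means transitive and preserving no nontrivial partition; regular means transitive with trivial point stabilisers. For $A\le\mathcal{S}_m$, $B\le\mathcal{S}_n$, the wreath product $A\wr B=A^{[n]}\rtimes B$ has underlying set $A^{[n]}\times B$ ($A^{[n]}$ being the group of functions $[n]\to A$ under pointwise multiplication) and multiplication $(\alpha,b)(\beta,c)=(\alpha\beta^{b^{-1}},bc)$, where $\beta^{b}(y)=\beta(yb^{-1})$. $A\wr_P B$ denotes $A\wr B$ acting on the set $[m]^{[n]}$ of functions $\omega\colon[n]\to[m]$ by $(\omega(\alpha,b))(y)=\omega(yb^{-1})\alpha(yb^{-1})$ (power action).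
   Formalization: Part (ii) is stated only for subgroups A with δ(A) > 0; if δ(A) = 0 (for example A trivial, m = 1) every δ(A ≀_P B) with B regular equals 0, so the set is {0} and is not dense in [0,1]. *)

(* Defs.v *)
From HB Require Import structures.
From mathcomp Require Import all_boot all_order all_fingroup all_solvable.
From mathcomp Require Import all_algebra.
From mathcomp Require Import all_classical all_reals all_analysis.

Set Implicit Arguments.
Unset Strict Implicit.
Unset Printing Implicit Defensive.

Import Order.TTheory GRing.Theory Num.Theory.
Import numFieldNormedType.Exports.

Local Open Scope group_scope.

(* The full wreath product of 'S_m and 'S_n.  It is an alias of the product   *)
(* type so that it does not inherit the direct product group structure.  In  *)
(* mathcomp permutations compose on the right: (b * c) y = c (b y), so the    *)
(* right-action notation y b translates to b y.                               *)
Definition wreath (m n : nat) : Type := ({ffun 'I_n -> 'S_m} * 'S_n)%type.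

HB.instance Definition _ m n := Finite.on (wreath m n).

Section Wreath.
Variables m n : nat.
Implicit Types (be : {ffun 'I_n -> 'S_m}) (b : 'S_n) (v w : wreath m n).

Definition wreath_twist be b : {ffun 'I_n -> 'S_m} :=
  [ffun y => be (b^-1 y)].

Definition wreath_one : wreath m n := (1, 1).

Definition wreath_mul v w : wreath m n :=
  (v.1 * wreath_twist w.1 v.2^-1, v.2 * w.2).

Definition wreath_inv w : wreath m n := (wreath_twist w.1^-1 w.2, w.2^-1).

Fact wreath_mulA : associative wreath_mul.
Proof.
move=> u v w; rewrite /wreath_mul /= mulgA; congr pair.
by apply/ffunP=> y; rewrite !ffunE !invgK permM mulgA.
Qed.

Fact wreath_mul1g : left_id wreath_one wreath_mul.
Proof.
case=> al b; rewrite /wreath_mul /= !mul1g; congr pair.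
by apply/ffunP=> y; rewrite ffunE invgK perm1.
Qed.

Fact wreath_mulVg : left_inverse wreath_one wreath_inv wreath_mul.
Proof.
case=> al b; rewrite /wreath_mul /= mulVg; congr pair.
by apply/ffunP=> y; rewrite !ffunE invgK mulVg.
Qed.

HB.instance Definition _ := Finite_isGroup.Build (wreath m n)
  wreath_mulA wreath_mul1g wreath_mulVg.

Fact wreath_mulE v w : v * w = wreath_mul v w.
Proof. by []. Qed.

Definition wreath_set (A : {set 'S_m}) (B : {set 'S_n}) : {set wreath m n} :=
  [set w : wreath m n | [forall y, w.1 y \in A] && (w.2 \in B)].

Fact wreath_group_set (A : {group 'S_m}) (B : {group 'S_n}) :
  group_set (wreath_set A B).
Proof.
apply/group_setP; split=> [|v w]; rewrite !inE /=.
  by rewrite group1 andbT; apply/forallP=> y; rewrite ffunE group1.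
case/andP=> /forallP vA vB /andP[/forallP wA wB].
rewrite groupM // andbT; apply/forallP=> y.
by rewrite !ffunE groupM.
Qed.

Canonical wreath_group (A : {group 'S_m}) (B : {group 'S_n}) :=
  Group (wreath_group_set A B).

Definition power_act (om : {ffun 'I_n -> 'I_m}) w : {ffun 'I_n -> 'I_m} :=
  [ffun y => w.1 (w.2^-1 y) (om (w.2^-1 y))].

Fact power_act1 : power_act^~ 1 =1 id.
Proof.
by move=> om; apply/ffunP=> y; rewrite !ffunE /= invg1 !perm1.
Qed.

Fact power_actM om : act_morph power_act om.
Proof.
move=> v w; apply/ffunP=> y; rewrite wreath_mulE !ffunE /= invgK invMg.
by rewrite !permM permKV.
Qed.

Canonical power_action := TotalAction power_act1 power_actM.

End Wreath.

(* Elements of G are counted, not the permutations they induce: G need not    *)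
(* act faithfully.                                                            *)
Definition derangement_proportion (R : realType) (aT : finGroupType)
    (T : finType) (to : {action aT &-> T}) (G : {group aT}) : R :=
  (#|[set g in G | [forall x, to x g != x]]|%:R / #|G|%:R)%R.

Definition primitive_perm (m : nat) (A : {group 'S_m}) : bool :=
  [primitive A, on [set: 'I_m] | 'P].

Definition regular_perm (n : nat) (B : {group 'S_n}) : bool :=
  [transitive B, on [set: 'I_n] | 'P] &&
  [forall y : 'I_n, 'C_B[y | 'P] == 1].

Definition dense_in (T : topologicalType) (D I : set T) : Prop :=
  (D `<=` I /\ I `<=` closure D)%classic.

(* Main.v *)
Require Import Defs.
From HB Require Import structures.
From mathcomp Require Import all_boot all_order all_fingroup all_solvable.
From mathcomp Require Import all_algebra.
From mathcomp Require Import all_classical all_reals all_analysis.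
From mathcomp Require Import ring lra.
Import Order.TTheory GRing.Theory Num.Theory.
Import numFieldNormedType.Exports.

Set Implicit Arguments.
Unset Strict Implicit.
Unset Printing Implicit Defensive.

(* An element (al, b) of A wr B fixes a point of the power action if and only *)
(* if, for every cycle of b, the product of al along that cycle fixes a       *)
(* point.  Given b, these products are independent and uniform in A, so that  *)
(* with x = 1 - delta(A) and c(b) the number of cycles of b,                  *)
(*     1 - delta(A wr_P B) = |B|^-1 \sum_(b in B) x ^ c(b).                   *)
(* (ii) Take B cyclic and regular of degree n, where n is the product of the  *)
(* primes in an interval [q, N[.  The phi(n) generators have one cycle and    *)
(* the other elements at least q cycles, so the right-hand side is within     *)
(* x ^ q of (phi(n) / n) x.  By Euler, the product of the 1 - 1/p over all    *)
(* primes diverges to 0, and its factors with p >= q are close to 1, hence    *)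
(* the ratios phi(n) / n are dense in [0, 1].                                 *)
(* (i) As the right-hand side is a polynomial in x that maps 0 to 0 and 1 to  *)
(* 1, it suffices that delta(A) is dense in [0, 1] for A primitive.  For this *)
(* apply (ii) to A = AGL(1, p), for which delta(A) is small and A wr_P B is   *)
(* primitive, A being 2-transitive of degree at least 3 and B transitive.     *)

(** * Fixed points of the power action *)

Definition cycle_prod (T : Type) (gT : groupType) (al : T -> gT) (f : T -> T)
    (k : nat) (y : T) : gT :=
  (\prod_(i < k) al (iter i f y))%g.

Lemma cycle_prod0 (T : Type) (gT : groupType) (al : T -> gT) f y :
  cycle_prod al f 0 y = 1%g.
Proof. exact: big_ord0. Qed.

Lemma cycle_prodSr (T : Type) (gT : groupType) (al : T -> gT) f k y :
  cycle_prod al f k.+1 y = (cycle_prod al f k y * al (iter k f y))%g.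
Proof. exact: big_ord_recr. Qed.

Lemma cycle_prodS (T : Type) (gT : groupType) (al : T -> gT) f k y :
  cycle_prod al f k.+1 y = (al y * cycle_prod al f k (f y))%g.
Proof.
rewrite /cycle_prod big_ord_recl; congr (_ * _)%g.
by apply: eq_bigr => i _; rewrite -iterSr.
Qed.

Section PowerFixed.
Variables m n : nat.
Implicit Types (al : {ffun 'I_n -> 'S_m}) (b : 'S_n) (om : {ffun 'I_n -> 'I_m}).

Lemma power_act_eqP om al b :
  reflect (forall z, om (b z) = al z (om z)) (power_act om (al, b) == om).
Proof.
apply: (iffP eqP) => [E z | E].
  by rewrite -[in LHS]E ffunE /= permK.
by apply/ffunP=> y; rewrite ffunE /= -E permKV.
Qed.

Lemma cycle_prod_orbit om al b (E : forall z, om (b z) = al z (om z)) k z :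
  om (iter k b z) = cycle_prod al b k z (om z).
Proof.
elim: k => [|k IHk]; first by rewrite cycle_prod0 perm1.
by rewrite iterS E IHk cycle_prodSr permM.
Qed.

(** Going once round a cycle, the equation for a fixed [om] forces the value at the root to be fixed
    by the cycle product. Conversely, a fixed point chosen at each root is propagated along its
    cycle, and being fixed by the cycle product is the consistency condition on returning to the
    root. *)
Lemma power_fixedP al b :
  reflect (exists om, power_act om (al, b) == om)
    [forall r in froots b, [exists x, cycle_prod al b (fingraph.order b r) r x == x]].
Proof.
have symb := fconnect_sym (@perm_inj _ b).
apply: (iffP forall_inP) => [H | [om /power_act_eqP E] r _]; last first.
  by apply/existsP; exists (om r);
    rewrite -(cycle_prod_orbit E) (iter_order (@perm_inj _ b)).
(* The implication makes the choice total. Since [m] may be 0, a value at a non-root [r] is borrowed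
   from the root of its cycle. *)
have H1 r : exists x, froots b r ==> (cycle_prod al b (fingraph.order b r) r x == x).
  case: (boolP (froots b r)) => [/H/existsP[x Hx]|_]; first by exists x.
  have /existsP[x _] := H _ (roots_root symb r).
  by exists x.
have [g Hg] := boolp.choice H1.
pose h k r := cycle_prod al b k r (g r).
pose om : {ffun 'I_n -> 'I_m} :=
  [ffun y => h (findex b (froot b y) y) (froot b y)].
exists om; apply/power_act_eqP => z.
have cz : fconnect b (froot b z) z by rewrite symb connect_root.
rewrite !ffunE; set r := froot b z; set i := findex b r z.
have iz : iter i b r = z by apply: iter_findex.
have -> : froot b (b z) = r.
  by apply/esym/eqP; rewrite (root_connect symb) fconnect1.
have -> : al z (h i r) = h i.+1 r by rewrite /h cycle_prodSr permM iz.
(* Either [z] is the last point of its cycle, so that [b z] is the root, or [b z] has the next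
   index. *)
have := findex_max cz; rewrite -/r -/i leq_eqVlt => /orP[/eqP Ei | lti].
  have -> : b z = r by rewrite -iz -iterS Ei (iter_order (@perm_inj _ b)).
  rewrite findex0 Ei /h cycle_prod0 perm1.
  by apply/esym/eqP/(implyP (Hg r)); rewrite roots_root.
by rewrite -iz -iterS findex_iter.
Qed.

Lemma root_tail_nroots b r i :
  froots b r -> 0 < i < fingraph.order b r -> ~~ froots b (iter i b r).
Proof.
have symb := fconnect_sym (@perm_inj _ b).
move=> /eqP rr /andP[i0 lti]; apply/negP => /eqP E.
have : froot b (iter i b r) = r.
  by rewrite -[RHS]rr; apply/esym/eqP; rewrite (root_connect symb) fconnect_iter.
rewrite E => Eir; move: (findex_iter lti); rewrite Eir findex0 => Ei.
by rewrite -Ei in i0.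
Qed.

(* Replaces the value of [al] at the root of each cycle of [b] by the product *)
(* of [al] around that cycle.  This is a bijection: the value at the root can *)
(* be recovered from that product and the other values.                       *)
Definition gauge b al : {ffun 'I_n -> 'S_m} :=
  [ffun y => if froots b y then cycle_prod al b (fingraph.order b y) y
             else al y].

Lemma gauge_inj b : injective (gauge b).
Proof.
move=> al be E; have Enr y : ~~ froots b y -> al y = be y.
  by move=> /negbTE ny; move/ffunP/(_ y): E; rewrite !ffunE ny.
apply/ffunP => y; case: (boolP (froots b y)) => [ry | /Enr//].
move/ffunP/(_ y): E; rewrite !ffunE ry -orderSpred !cycle_prodS.
suff -> : cycle_prod al b (fingraph.order b y).-1 (b y) =
          cycle_prod be b (fingraph.order b y).-1 (b y) by apply: mulIg.
apply: eq_bigr => i _; apply: Enr; rewrite -iterSr root_tail_nroots //=.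
by have := ltn_ord i; rewrite -ltnS orderSpred.
Qed.

(** When the other factors of a cycle product lie in [A], the product lies in [A] exactly if the
    value at the root does. *)
Lemma gauge_group b al (A : {group 'S_m}) :
  [forall y, gauge b al y \in A] = [forall y, al y \in A].
Proof.
have Et y : froots b y -> (forall z, ~~ froots b z -> al z \in A) ->
    cycle_prod al b (fingraph.order b y).-1 (b y) \in A.
  move=> ry H; apply: group_prod => i _.
  apply: H; rewrite -iterSr root_tail_nroots //=.
  by have := ltn_ord i; rewrite -ltnS orderSpred.
apply/forallP/forallP => H y; case: (boolP (froots b y)) => ry.
- have := H y; rewrite ffunE ry -orderSpred cycle_prodS groupMr //.
  by apply: Et => // z /negbTE nz; move: (H z); rewrite ffunE nz.
- by move: (H y); rewrite ffunE (negbTE ry).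
- by rewrite ffunE ry; apply: group_prod.
- by rewrite ffunE (negbTE ry).
Qed.

(** After the change of variables [gauge b], the conditions decouple: the value at a root must lie
    in [A] and fix a point, and every other value ranges freely over [A]. *)
Lemma card_power_fixed b (A : {group 'S_m}) :
  #|[set al : {ffun 'I_n -> 'S_m} | [forall y, al y \in A] &&
       [exists om, power_act om (al, b) == om]]| =
  (#|[set a in A | [exists x, a x == x]]| ^ fcard b 'I_n *
   #|A| ^ (n - fcard b 'I_n))%N.
Proof.
set F := [set a in A | _].
pose D y : {set 'S_m} := if froots b y then F else A.
have -> : [set al : {ffun 'I_n -> 'S_m} | [forall y, al y \in A] &&
             [exists om, power_act om (al, b) == om]] =
          gauge b @^-1: [set be in family D].
  apply/setP => al; rewrite !inE -(gauge_group b).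
  rewrite (sameP existsP (power_fixedP al b)).
  have memD z y : in_mem z (finfun.fmem D y) = (z \in D y) by [].
  apply/andP/forallP => [[/forallP H1 /forall_inP H2] y | H].
    rewrite memD /D; have := H1 y; rewrite ffunE; case: (boolP (froots b y)) => // ry.
    by move=> yA; rewrite /F inE yA; apply: H2.
  split; first apply/forallP => y.
    by have := H y; rewrite memD /D; case: ifP => // _ /setIdP[].
  apply/forall_inP => r rr; have := H r.
  by rewrite memD ffunE /D (_ : froots b r) // => /setIdP[].
rewrite card_preimset; last exact: gauge_inj.
rewrite cardsE card_family foldrE big_map big_enum /=.
rewrite (bigID (froots b)) /=; congr (_ * _)%N.
  rewrite (eq_bigr (fun _ => #|F|)); last by move=> y ry; rewrite /D ry.
  by rewrite prod_nat_const; congr (_ ^ _)%N; apply: eq_card => y; rewrite !inE andbT.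
rewrite (eq_bigr (fun _ => #|A|)); last by move=> y ry; rewrite /D (negbTE ry).
rewrite prod_nat_const; congr (_ ^ _)%N.
apply: (canRL (addKn _)).
rewrite -[RHS]card_ord -(cardC (froots b)); congr (_ + _)%N.
by apply: eq_card => y; rewrite !inE andbT.
Qed.

End PowerFixed.

Lemma derangement_proportionE (R : realType) (aT : finGroupType) (T : finType)
    (to : {action aT &-> T}) (G : {group aT}) :
  derangement_proportion R to G =
  (1 - #|[set g in G | [exists x, to x g == x]]|%:R / #|G|%:R)%R.
Proof.
rewrite /derangement_proportion.
have -> : [set g in G | [exists x, to x g == x]] =
          G :\: [set g in G | [forall x, to x g != x]].
  apply/setP => g; rewrite !inE; case: (g \in G); rewrite ?andbF //= andbT.
  by rewrite negb_forall; apply: eq_existsb => x; rewrite negbK.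
rewrite cardsDS; last by apply/fintype.subsetP => g /setIdP[].
rewrite natrB; last by apply: subset_leq_card; apply/fintype.subsetP => g /setIdP[].
rewrite mulrBl divff ?pnatr_eq0 -?lt0n ?cardG_gt0 //.
by rewrite opprB addrC subrK.
Qed.

Lemma derangement_proportion_power (R : realType) (m n : nat)
    (A : {group 'S_m}) (B : {group 'S_n}) :
  (derangement_proportion R (power_action m n) (wreath_group A B) =
   1 - (\sum_(b in B) (1 - derangement_proportion R 'P A) ^+ fcard b 'I_n)
       / #|B|%:R)%R.
Proof.
rewrite [derangement_proportion R _ A]derangement_proportionE subKr.
rewrite derangement_proportionE; congr (1 - _)%R.
have A0 : (#|A|%:R != 0 :> R)%R by rewrite pnatr_eq0 -lt0n cardG_gt0.
have B0 : (#|B|%:R != 0 :> R)%R by rewrite pnatr_eq0 -lt0n cardG_gt0.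
have cG : #|wreath_group A B| = (#|A| ^ n * #|B|)%N.
  have -> : (#|A| ^ n = #|[set al : {ffun 'I_n -> 'S_m} | al \in ffun_on A]|)%N.
    by rewrite cardsE card_ffun_on card_ord.
  by rewrite -cardsX; apply: eq_card => -[al b]; rewrite !inE.
rewrite cG natrM natrX invfM mulrA [in RHS]mulrC [LHS]mulrC; congr (_ * _)%R.
apply: (canLR (mulfK _)); first by rewrite expf_neq0.
rewrite mulr_suml.
have -> : #|[set g in wreath_group A B |
             [exists x, power_action m n x g == x]]| =
          (\sum_(b in B) #|[set al : {ffun 'I_n -> 'S_m} | [forall y, al y \in A] &&
                [exists om, power_act om (al, b) == om]]|)%N.
  pose fixP (w : wreath m n) := [exists om, power_act om w == om].
  rewrite -sum1dep_card (eq_bigl (fun w : wreath m n =>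
     (w.2 \in B) && ([forall y, w.1 y \in A] && fixP w))); last first.
    by move=> [al b]; rewrite !inE /= andbAC andbC.
  under [RHS]eq_bigr => b _ do rewrite -sum1dep_card.
  rewrite (exchange_big_dep xpredT) //= pair_big_dep /=.
  exact: eq_bigl.
rewrite natr_sum; apply: eq_bigr => b _; rewrite card_power_fixed natrM !natrX.
rewrite expr_div_n -mulrA; congr (_ * _)%R.
have le : (fcard b 'I_n <= n)%N by rewrite -[leqRHS](card_ord n) max_card.
have -> : (#|A|%:R ^+ n = #|A|%:R ^+ fcard b 'I_n * #|A|%:R ^+ (n - fcard b 'I_n) :> R)%R.
  by rewrite -exprD subnKC.
by rewrite mulKf ?expf_neq0.
Qed.

(** * Regular and primitive actions *)

Lemma card_regular_perm (n : nat) (B : {group 'S_n}) :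
  (0 < n)%N -> regular_perm B -> #|B| = n.
Proof.
move=> n0 /andP[trB /forallP regB]; pose y := Ordinal n0.
rewrite -(card_orbit_stab 'P B y) (eqP (regB y)) cards1 muln1.
by rewrite (atransP trB) ?inE // cardsT card_ord.
Qed.

(** A power of [b] that fixes a point is trivial, so all cycles of [b] have length [#[b]]. *)
Lemma fcard_regular_perm (n : nat) (B : {group 'S_n}) b :
  regular_perm B -> b \in B -> (fcard b 'I_n * #[b]%g = n)%N.
Proof.
move=> /andP[_ /forallP regB] bB.
have ord_b y : fingraph.order b y = #[b]%g.
  have sbB : (<[b]> \subset B)%g by rewrite cycle_subG.
  have st : ('C_(<[b]>)[y | 'P] = 1)%g.
    by apply/trivgP; rewrite -(eqP (regB y)) finset.setSI.
  rewrite orderE -(card_orbit_stab 'P <[b]>%g y) st cards1 muln1 /=.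
  apply: eq_card => z; apply/idP/orbitP => [cz | [_ /cycleP[i ->] <-]].
    exists (b ^+ findex b y z)%g; first exact: mem_cycle.
    by rewrite /= apermE permX iter_findex.
  by rewrite /= apermE permX inE fconnect_iter.
rewrite -[RHS]card_ord; apply: (fcard_order_set (@perm_inj _ b)) => //.
by apply/fintype.subsetP => y _; rewrite inE ord_b.
Qed.

(** The witness is the full cycle. In a transitive abelian group, an element that fixes one point
    fixes all of them. *)
Lemma exists_regular_cyclic (n : nat) : (0 < n)%N ->
  exists c : 'S_n, regular_perm <[c]>.
Proof.
case: n => [//|n] _; pose c : 'S_n.+1 := perm (@ordS_inj n.+1).
have cX i y : ((c ^+ i)%g y = (i + y) %% n.+1 :> nat)%N.
  elim: i => [|i IHi]; first by rewrite expg0 perm1 add0n modn_small.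
  by rewrite expgSr permM permE /= IHi -addn1 modnDml addn1.
exists c; apply/andP; split.
  apply/imsetP; exists ord0; first by rewrite finset.in_setT.
  apply/setP => y.
  rewrite finset.in_setT; apply/esym.
  apply/orbitP; exists (c ^+ y)%g; first exact: mem_cycle.
  by apply/val_inj; rewrite /= apermE cX addn0 modn_small.
apply/forallP => y; rewrite finset.eqEsubset sub1G andbT.
apply/fintype.subsetP => b /setIP[/cycleP[j ->] /astab1P /= byy].
rewrite inE; apply/eqP/permP => z; rewrite perm1.
have [i <-] : exists i, (c ^+ i)%g y = z.
  exists (z + (n.+1 - y))%N; apply/val_inj; rewrite /= cX -addnA subnK 1?ltnW //.
  by rewrite modnDr modn_small.
have {}byy : (c ^+ j)%g y = y by [].
by rewrite -permM -expgD addnC expgD permM byy.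
Qed.

Definition two_transitive (T : finType) (A : {set {perm T}}) : Prop :=
  forall x y x' y', x != y -> x' != y' ->
    exists2 s : {perm T}, s \in A & s x = x' /\ s y = y'.

Definition no_invariant_rel (aT : finGroupType) (T : finType)
    (to : {action aT &-> T}) (G : {set aT}) : Prop :=
  forall e : rel T, equivalence_rel e ->
    (forall g u v, g \in G -> e u v -> e (to u g) (to v g)) ->
    forall u v, u != v -> e u v -> forall x y, e x y.

(** Lying in the same block is an invariant equivalence. With fewer blocks than points it relates
    two distinct points, hence all points, and there is only one block. *)
Lemma primitive_of_rel (aT : finGroupType) (T : finType)
    (to : {action aT &-> T}) (G : {group aT}) :
  [transitive G, on [set: T] | to] -> no_invariant_rel to G ->
  [primitive G, on [set: T] | to].
Proof.
move=> trG prim; rewrite /primitive trG; apply/existsP => -[Q].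
case/and3P => /and3P[/eqP covQ tiQ Q0] actQ /andP[Q1 ltQ].
have inQ x : x \in finset.cover Q by rewrite covQ finset.in_setT.
pose e := [rel u v | finset.pblock Q u == finset.pblock Q v].
have eE : equivalence_rel e.
  by move=> x y z; split => //= /eqP->.
have eG g u v : g \in G -> e u v -> e (to u g) (to v g).
  move=> gG /= /eqP E; have XQ : (to^*)%act (finset.pblock Q u) g \in Q.
    by rewrite (actsP actQ) // finset.pblock_mem.
  have blk w : finset.pblock Q u = finset.pblock Q w ->
      finset.pblock Q (to w g) = (to^*)%act (finset.pblock Q u) g.
    by move=> Ew; apply: finset.def_pblock => //; rewrite Ew (imset_f (to^~ g)) // finset.mem_pblock.
  by rewrite (blk u) // (blk v).
have [u [v [neq uv]]] : exists u v, u != v /\ e u v.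
  case: (boolP (injectiveb (finset.pblock Q))) => [/injectiveP inj | /injectivePn].
    move: ltQ; rewrite -(card_imset _ inj) ltnNge => /negP[].
    apply: subset_leq_card; apply/fintype.subsetP => _ /imsetP[x _ ->].
    exact: finset.pblock_mem.
  by case=> u [v neq E]; exists u, v; rewrite /= E.
have all_e := prim e eE eG u v neq uv.
have : Q \subset [set finset.pblock Q u].
  apply/fintype.subsetP => X XQ; rewrite inE.
  have [E|[x xX]] := set_0Vmem X; first by rewrite -E XQ in Q0.
  by rewrite -(finset.def_pblock tiQ XQ xX) (eqP (all_e x u)).
by move/subset_leq_card; rewrite cards1 leqNgt Q1.
Qed.

Section PowerPrimitive.
Variables m n : nat.
Variables (A : {group 'S_m}) (B : {group 'S_n}).
Hypothesis trA : two_transitive A.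
Hypothesis m3 : (2 < m)%N.
Hypothesis trB : [transitive B, on [set: 'I_n] | 'P].

(** Provides a value distinct from both [u i] and [v i] in the primitivity argument. For [m = 2]
    there is none, and the pairs of opposite vertices of the cube form a block system. *)
Let exists_third (x y : 'I_m) : exists2 z, x != z & y != z.
Proof.
suff /fintype.subsetPn[z _] : ~~ ([set: 'I_m] \subset [set x; y]).
  by rewrite !inE negb_or ![z == _]eq_sym => /andP[]; exists z.
apply: contraTN m3 => /subset_leq_card; rewrite cardsT card_ord -leqNgt => le.
by rewrite (leq_trans le) // cards2; case: eqP.
Qed.

Let two_trans_trans x y : exists2 s : 'S_m, s \in A & s x = y.
Proof.
have [x' nx _] := exists_third x x; have [y' ny _] := exists_third y y.
by have [s sA [sx _]] := trA nx ny; exists s.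
Qed.

Lemma base_in (al : {ffun 'I_n -> 'S_m}) : (forall y, al y \in A) ->
  (al, 1%g) \in wreath_group A B.
Proof. by move=> H; rewrite inE /= group1 andbT; apply/forallP. Qed.

Lemma base_actE om (al : {ffun 'I_n -> 'S_m}) y :
  power_action m n om (al, 1%g) y = al y (om y).
Proof. by rewrite /= ffunE /= invg1 perm1. Qed.

Lemma base_moves om om' : exists2 al : {ffun 'I_n -> 'S_m},
  (al, 1%g) \in wreath_group A B & power_action m n om (al, 1%g) = om'.
Proof.
have /fin_all_exists[g H] y : exists s : 'S_m, s \in A /\ s (om y) = om' y.
  by have [s] := two_trans_trans (om y) (om' y); exists s.
exists (finfun g); first by apply: base_in => y; rewrite ffunE; case: (H y).
by apply/ffunP => y; rewrite base_actE ffunE; case: (H y).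
Qed.

Lemma power_transitive :
  [transitive wreath_group A B, on [set: {ffun 'I_n -> 'I_m}] | power_action m n].
Proof.
pose x0 := Ordinal (ltnW (ltnW m3)).
apply/imsetP; exists [ffun=> x0] => //; apply/finset.setP => om.
rewrite finset.in_setT; apply/esym/orbitP.
by have [al] := base_moves [ffun=> x0] om; exists (al, 1%g).
Qed.

Definition update (T : Type) (om : {ffun 'I_n -> T}) (i : 'I_n) (x : T) :
  {ffun 'I_n -> T} := [ffun y => if y == i then x else om y].

(* An invariant equivalence relating two distinct points relates two points   *)
(* that differ in a single coordinate, since two-transitivity lets us move    *)
(* one of them in one coordinate while fixing the other; then it relates all  *)
(* such pairs.                                                                *)
Lemma power_no_invariant_rel : no_invariant_rel (power_action m n) (wreath_group A B).
Proof.
move=> e eE eG u v neq euv.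
have e_refl x : e x x by case: (eE x x x).
have e_sym x y : e x y = e y x.
  by apply/idP/idP => exy; [have [_ <-] := eE x y x | have [_ <-] := eE y x y].
have e_trans x y z : e x y -> e y z -> e x z.
  by move=> exy; have [_ /(_ exy) <-] := eE x y z.
have [i uv_i] : exists i, u i != v i.
  apply/existsP; apply: contraR neq => /existsPn H; apply/eqP/ffunP => i.
  by apply/eqP; rewrite -[_ == _]negbK.
have [w wu wv] : exists2 w, u i != w & v i != w by exact: exists_third.
have [s sA [su sv]] := trA uv_i wu.
have step1 : e v (update v i w).
  apply: (e_trans _ u); first by rewrite e_sym.
  pose al : {ffun 'I_n -> 'S_m} := [ffun y => if y == i then s else 1%g].
  have alG : (al, 1%g) \in wreath_group A B.
    by apply: base_in => y; rewrite ffunE; case: ifP.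
  have := eG _ _ _ alG euv; congr (e _ _); apply/ffunP => y;
    rewrite base_actE !ffunE; case: eqP => [zi|_];
    by rewrite ?zi ?perm1.
(* Two-transitivity carries the pair [v i], [w] to [x], [y] in coordinate [i], while the other
   coordinates of [v] are moved to those of [om]. *)
have step2 om x y : e (update om i x) (update om i y).
  have [->|xy] := eqVneq x y; first exact: e_refl.
  have [s' s'A [s'v s'w]] := trA wv xy.
  have [al alG alE] := base_moves v om.
  pose al' := update al i s'.
  have al'G : (al', 1%g) \in wreath_group A B.
    apply: base_in => z; rewrite ffunE; case: ifP => // _.
    by move: alG; rewrite inE => /andP[/forallP].
  have := eG _ _ _ al'G step1; congr (e _ _); apply/ffunP => z;
    rewrite base_actE !ffunE; case: eqP => [zi|_];
    by rewrite ?zi // -alE base_actE.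
(* An element of [B] carries coordinate [i] to [j]; composing [om] with [b] beforehand cancels its
   effect on the other coordinates. *)
have step3 om j x y : e (update om j x) (update om j y).
  have [b bB bij] := atransP2 trB (finset.in_setT i) (finset.in_setT j).
  have bG : ([ffun=> 1%g], b) \in wreath_group A B.
    by rewrite inE bB andbT; apply/forallP => z; rewrite ffunE.
  have := eG _ _ _ bG (step2 [ffun z => om (b z)] x y).
  congr (e _ _); apply/ffunP => z; rewrite /= !ffunE /= perm1;
    by rewrite permKV bij /= -(inj_eq (@perm_inj _ b)) permKV.
(* The coordinates of [f] are replaced by those of [g] one at a time. *)
move=> f g; suff H (r : seq 'I_n) : e f [ffun y => if y \in r then g y else f y].
  have := H (enum 'I_n); congr (e _ _); apply/ffunP => y.
  by rewrite ffunE mem_enum.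
elim: r => [|j r IHr].
  by rewrite [X in e _ X](_ : _ = f) //; apply/ffunP => y; rewrite ffunE.
apply: e_trans IHr _; set h := [ffun y => _].
have -> : [ffun y => if y \in j :: r then g y else f y] = update h j (g j).
  by apply/ffunP => y; rewrite !ffunE inE; case: eqP => [->|].
rewrite [X in e X _](_ : h = update h j (h j)) //.
by apply/ffunP => y; rewrite [RHS]ffunE; case: eqP => [->|].
Qed.

End PowerPrimitive.

Section PermAction.
Variables (aT : finGroupType) (T : finType) (to : {action aT &-> T}).

(** Transports the action to an ordinal: the theorem asks for subgroups of symmetric groups ['S_m],
    whereas the wreath products act on sets of functions. *)
Definition rank_act (x : 'I_#|T|) (g : aT) : 'I_#|T| :=
  enum_rank (to (enum_val x) g).

Lemma rank_act1 : rank_act^~ 1%g =1 id.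
Proof. by move=> x; rewrite /rank_act act1 enum_valK. Qed.

Lemma rank_actM x : act_morph rank_act x.
Proof. by move=> g h; rewrite /rank_act enum_rankK actM. Qed.

Canonical rank_action := TotalAction rank_act1 rank_actM.

(** Having no fixed point depends only on the induced permutation, and every permutation in the
    image is induced by equally many elements of [G], namely as many as the kernel has. *)
Lemma derangement_proportion_actperm (R : realType) (G : {group aT}) :
  derangement_proportion R 'P (actperm rank_action @* G) =
  derangement_proportion R to G.
Proof.
set f := actperm rank_action.
have fE g x : f g x = rank_act x g by rewrite actpermE.
have fiber (S : {set 'S_#|T|}) : S \subset (f @* G)%g ->
    #|[set g in G | f g \in S]| = (#|('ker_G f)%g| * #|S|)%N.
  move=> /fintype.subsetP sS.
  rewrite -sum1dep_card (partition_big f (mem S)) => [|g /andP[]//].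
  rewrite mulnC -sum_nat_const; apply: eq_bigr => a aS.
  have /morphimP[h _ hG aE] := sS a aS; rewrite {a}aE in aS *.
  rewrite -(card_rcoset _ h) sum1_card; apply: eq_card => g.
  rewrite mem_rcoset !inE groupMr ?groupV //.
  rewrite morphM ?finset.in_setT // morphV ?finset.in_setT // -eq_mulgV1.
  rewrite -[LHS]/((g \in G) && (f g \in S) && (f g == f h)) -/(f g) -/(f h).
  by case: eqP => [->|_]; rewrite ?(aS : f h \in S) ?andbT ?andbF /= ?andbF.
have fG : #|G| = (#|('ker_G f)%g| * #|(f @* G)%g|)%N.
  rewrite -fiber //; apply: eq_card => g; rewrite inE; apply/esym/andb_idr.
  by move=> gG; rewrite mem_morphim // finset.in_setT.
rewrite /derangement_proportion fG.
have -> : [set g in G | [forall x, to x g != x]] =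
    [set g in G | f g \in [set a in (f @* G)%g | [forall x, 'P%act x a != x]]].
  apply/finset.setP => g; rewrite !inE; case gG: (g \in G) => //=.
  rewrite (mem_morphim f (finset.in_setT g) gG) /=.
  apply/forallP/forallP => H x.
    rewrite apermE fE /rank_act; apply: contraNneq (H (enum_val x)) => E.
    by rewrite -[X in _ == enum_val X]E enum_rankK.
  apply: contraNneq (H (enum_rank x)) => E.
  by rewrite apermE fE /rank_act enum_rankK E.
rewrite fiber; last by apply/fintype.subsetP => a /setIdP[].
rewrite !natrM invfM mulrACA divff ?mul1r //.
by rewrite pnatr_eq0 -lt0n cardG_gt0.
Qed.

End PermAction.

Lemma perm_group_of_action (R : realType) (aT : finGroupType) (T : finType)
    (to : {action aT &-> T}) (G : {group aT}) :
  [transitive G, on [set: T] | to] -> no_invariant_rel to G ->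
  exists A : {group 'S_#|T|}, primitive_perm A /\
    derangement_proportion R 'P A = derangement_proportion R to G.
Proof.
move=> trG nrG; exists (actperm (rank_action to) @* G)%G; split; last first.
  exact: derangement_proportion_actperm.
have fE g x : actperm (rank_action to) g x = rank_act to x g by rewrite actpermE.
apply: primitive_of_rel.
  have /imsetP[x _ xG] := trG.
  apply/imsetP; exists (enum_rank x) => //; apply/finset.setP => y.
  rewrite finset.in_setT; apply/esym/orbitP.
  have : enum_val y \in orbit to G x by rewrite -xG finset.in_setT.
  case/orbitP => g gG gx; exists (actperm (rank_action to) g).
    by rewrite mem_morphim // finset.in_setT.
  by rewrite /= apermE fE /rank_act enum_rankK gx enum_valK.
move=> e eE eG u v neq euv x y.
pose e' := [rel x y : T | e (enum_rank x) (enum_rank y)].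
have /= := nrG e' _ _ (enum_val u) (enum_val v) _ _ (enum_val x) (enum_val y).
rewrite !enum_valK; apply => //.
- by move=> a b c; apply: eE.
- move=> g a b gG /= /(eG (actperm (rank_action to) g)).
  rewrite /= !apermE !fE /rank_act !enum_rankK; apply.
  by rewrite mem_morphim // finset.in_setT.
- by rewrite (inj_eq enum_val_inj).
Qed.

Local Open Scope ring_scope.

(** * Density of the ratios phi(n) / n *)

(* False at [k = 0], by the convention of [pnat]. *)
Definition smooth (j k : nat) : bool := [pred q | (q < j)%N].-nat k.

Definition smooth_harmonic (R : realType) (j N : nat) : R :=
  \sum_(k < N.+1 | smooth j k) (k%:R)^-1.

(** One Euler factor: the terms divisible by [p] add up to at most [p^-1] times the whole sum.
    Truncation at [N] leaves only an inequality. *)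
Lemma smooth_harmonic_prime (R : realType) (p N : nat) : prime p ->
  smooth_harmonic R p.+1 N * (1 - p%:R^-1) <= smooth_harmonic R p N.
Proof.
move=> pr_p; have p0 := prime_gt0 pr_p.
rewrite mulrBr mulr1 lerBlDr {1}/smooth_harmonic (bigID (fun k : 'I__ => (p %| k)%N)).
rewrite /= addrC; apply: lerD.
  rewrite /smooth_harmonic big_mkcond [leRHS]big_mkcond; apply: ler_sum => k _.
  case: ifP => [/andP[/andP[k0 /allP sk] npk] | _]; last first.
    by case: ifP => // _; rewrite invr_ge0.
  rewrite [smooth _ _](_ : _ = true) //; apply/andP; split => //.
  apply/allP => q qk; have := sk q qk; rewrite !inE ltnS leq_eqVlt.
  case/orP => // /eqP qp; move: npk.
  by move: qk; rewrite mem_primes qp => /and3P[_ _ ->].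
(* Writing [k = p * i], the terms divisible by [p] are [p^-1] times terms of  *)
(* the sum itself.                                                            *)
rewrite (reindex_onto (fun i : 'I_N.+1 => inord (p * i))
                      (fun i : 'I_N.+1 => inord (i %/ p))); last first.
  move=> i /andP[_ pi]; apply/val_inj; rewrite /= [X in (p * X)%N]inordK.
    by rewrite muln_divCA // divnn p0 muln1 inord_val.
  by rewrite (leq_ltn_trans (leq_div _ _)).
rewrite mulr_suml big_mkcond [leRHS]big_mkcond; apply: ler_sum => k _.
case: ifP => [/andP[/andP[sk pk] _] | _]; last first.
  by case: ifP => // _; rewrite mulr_ge0 ?invr_ge0.
(* Beyond [N], [inord] returns its default 0, which is not smooth. *)
case: (ltnP (p * k) N.+1) => lt; last first.
  by move: sk; rewrite /smooth /inord val_insubd ltnNge lt /=.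
move: sk pk; rewrite inordK // /smooth pnatM => /andP[_ ->] _.
by rewrite natrM invfM mulrC.
Qed.

(** Removing the primes below [j] one at a time leaves at most the term [k = 1]. *)
Lemma harmonic_smooth_le (R : realType) (j N : nat) :
  smooth_harmonic R j N * \prod_(0 <= p < j | prime p) (1 - p%:R^-1) <= 1.
Proof.
elim: j => [|j IHj].
  rewrite big_geq // mulr1 /smooth_harmonic.
  apply: (@le_trans _ _ (\sum_(k < N.+1 | k == 1%N :> nat) 1)); last first.
    rewrite sumr_const -[leRHS]/(1%:R) ler_nat -[leqRHS](cards1 (inord 1 : 'I_N.+1)).
    apply: subset_leq_card; apply/fintype.subsetP => k /eqP k1.
    by rewrite inE -k1 inord_val.
  rewrite big_mkcond [leRHS]big_mkcond; apply: ler_sum => k _.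
  case: ifP => [/andP[k0 /allP sk] | _]; last by case: ifP.
  case: (eqVneq (k : nat) 1%N) => [-> | k1]; first by rewrite invr1.
  by have := sk (pdiv k); rewrite pi_pdiv ltn_neqAle eq_sym k1 k0 => /(_ isT).
rewrite big_mkcond big_nat_recr //= -big_mkcond /=.
case: ifP => [pr_j | /negP npr].
  apply: le_trans IHj; rewrite mulrA mulrAC; apply: ler_wpM2r; last exact: smooth_harmonic_prime.
  apply: prodr_ge0 => p pr_p; rewrite subr_ge0 invf_le1 ?ler1n ?ltr0n ?prime_gt0 //.
rewrite mulr1; apply: le_trans IHj; rewrite le_eqVlt; apply/orP; left; apply/eqP.
congr (_ * _); apply: eq_bigl => k; rewrite /smooth /pnat; congr andb.
apply: eq_in_all => q; rewrite mem_primes => /and3P[pr_q _ _]; rewrite !inE ltnS.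
by rewrite leq_eqVlt; case: eqP => // qj; rewrite qj in pr_q.
Qed.

(** Every positive [k <= N] is [N.+1]-smooth, so the smooth sum is a full partial sum of the
    harmonic series, which diverges. *)
Lemma euler_product_cvg0 (R : realType) (P : nat) (e : R) : 0 < e ->
  exists2 N, (P <= N)%N & \prod_(0 <= p < N | prime p) (1 - p%:R^-1) < e.
Proof.
move=> e0.
have hinc : {homo (series (@harmonic R)) : n m / (n <= m)%N >-> n <= m}.
  by apply: nondecreasing_series => k _ _; apply: harmonic_ge0.
have := nondecreasing_dvgn_lt hinc (@dvg_harmonic R).
move=> /cvgryPgt/(_ e^-1)[N0 _ /(_ (maxn N0 P) (leq_maxl _ _)) /=].
set N := maxn N0 P => HN.
exists N.+1; first by rewrite (leq_trans (leq_maxr N0 P)).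
have := harmonic_smooth_le R N.+1 N.
have -> : smooth_harmonic R N.+1 N = series (@harmonic R) N.
  rewrite /smooth_harmonic big_mkcond big_ord_recl /= add0r /series /= big_mkord.
  apply: eq_bigr => k _; rewrite ifT //; apply/pnatP => // q pr_q /dvdn_leq.
  by move=> /(_ isT) ?; rewrite inE ltnS (leq_trans _ (ltn_ord k)).
rewrite mulrC => H; have S0 : 0 < series (@harmonic R) N.
  by apply: lt_trans HN; rewrite invr_gt0.
apply: (@le_lt_trans _ _ (series (@harmonic R) N)^-1).
  by rewrite -[leRHS]div1r ler_pdivlMr.
by rewrite -[ltRHS]invrK ltf_pV2 // posrE invr_gt0.
Qed.

Lemma totient_rough_prod (R : realType) (P N : nat) :
  let n := (\prod_(P <= p < N | prime p) p)%N in
  [/\ (0 < n)%N, (forall q, prime q -> (q %| n)%N -> (P <= q < N)%N) &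
      (totient n)%:R / n%:R = \prod_(P <= p < N | prime p) (1 - p%:R^-1) :> R].
Proof.
elim: N => [|N [n0 dvdn IHN]] /=.
  rewrite !big_geq //; split; rewrite ?totient1 ?divr1 // => q pr_q.
  by rewrite Euclid_dvd1.
have [lePN | ltNP] := leqP P N; last first.
  rewrite !big_geq //; split; rewrite ?totient1 ?divr1 // => q pr_q.
  by rewrite Euclid_dvd1.
rewrite big_mkcond [in X in _ = X]big_mkcond !big_nat_recr //= -!big_mkcond /=.
case: ifP => [pr_N | _]; last first.
  rewrite muln1 mulr1; split => // q pr_q /(dvdn q pr_q)/andP[-> ltqN].
  by rewrite (leq_trans ltqN).
split; first by rewrite muln_gt0 n0 prime_gt0.
  move=> q pr_q; rewrite Euclid_dvdM // => /orP[/(dvdn q pr_q)/andP[-> ltqN] |].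
    by rewrite (leq_trans ltqN).
  by rewrite dvdn_prime2 // => /eqP->; rewrite lePN /=.
have cop : coprime (\prod_(P <= p < N | prime p) p) N.
  rewrite coprime_sym prime_coprime //; apply/negP => /(dvdn N pr_N).
  by rewrite ltnn andbF.
rewrite totient_coprime // !natrM invfM mulrACA IHN totient_prime //; congr (_ * _).
rewrite -subn1 natrB ?prime_gt0 // mulrBl divff ?mul1r //.
by rewrite pnatr_eq0 -lt0n prime_gt0.
Qed.

(** The products over the primes in [K, N[ start at 1, tend to 0 as [N] grows, and drop by at most
    [e / 2] at each step. The first one not above [t + e / 2] is therefore close to [t]. *)
Lemma totient_ratio_dense (R : realType) (P : nat) (t e : R) :
  0 <= t <= 1 -> 0 < e ->
  exists n, [/\ (0 < n)%N, (forall q, prime q -> (q %| n)%N -> (P <= q)%N) &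
    `|(totient n)%:R / n%:R - t| < e].
Proof.
move=> /andP[t0 t1] e0.
pose K := maxn P (Num.truncn (2 / e)).+1.
have Ke (N : nat) : (K <= N)%N -> N%:R^-1 < e / 2.
  move=> leKN; rewrite -[ltRHS]invrK ltf_pV2 ?posrE ?invr_gt0 ?divr_gt0 //.
    rewrite invf_div; apply: lt_le_trans (truncnS_gt _) _.
    by rewrite ler_nat (leq_trans _ leKN) // leq_maxr.
  by rewrite ltr0n (leq_trans _ leKN) // (leq_trans _ (leq_maxr _ _)).
pose a N : R := \prod_(K <= p < N | prime p) (1 - p%:R^-1).
have p_ge1 p : prime p -> 0 < 1 - p%:R^-1 :> R /\ 1 - p%:R^-1 <= (1 : R).
  move=> pr_p; split; last by rewrite gerBl invr_ge0.
  by rewrite subr_gt0 invf_lt1 ?ltr1n ?ltr0n ?prime_gt1 ?prime_gt0.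
have aS N : (K <= N)%N -> a N - e / 2 <= a N.+1.
  move=> leKN; rewrite {2}/a big_mkcond big_nat_recr //= -big_mkcond /= -/(a N).
  case: ifP => [pr_N | _]; last by rewrite mulr1 gerBl divr_ge0 // ltW.
  rewrite mulrBr mulr1 lerB // (le_trans _ (ltW (Ke N leKN))) //.
  rewrite ler_piMl ?invr_ge0 //; apply: Num.Theory.prodr_ile1 => p /p_ge1[p0 p1].
  by rewrite ltW.
(* The primes below [K] contribute a fixed positive factor, so the tail product tends to 0 as
   well. *)
have [N0 leKN0 aN0] : exists2 N, (K <= N)%N & a N < e / 2.
  have c0 : 0 < \prod_(0 <= p < K | prime p) (1 - p%:R^-1 : R).
    by apply: prodr_gt0 => p /p_ge1[].
  have [N leKN HN] := euler_product_cvg0 K (mulr_gt0 c0 (divr_gt0 e0 (ltr0Sn R 1))).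
  by exists N => //; move: HN; rewrite (big_cat_nat (leq0n K) leKN) //= ltr_pM2l.
pose Q N := (K <= N)%N && (a N <= t + e / 2).
have exQ : exists N, Q N.
  by exists N0; rewrite /Q leKN0 (le_trans (ltW aN0)) // lerDr.
case: (ex_minnP exQ) => N /andP[leKN aN] minN.
have [n0 n_rough ratio] := totient_rough_prod R K N.
exists (\prod_(K <= p < N | prime p) p)%N; split => //.
  by move=> q pr_q /(n_rough q pr_q)/andP[+ _]; apply: leq_trans; apply: leq_maxl.
rewrite ratio -/(a N); rewrite ltr_norml; apply/andP; split; last first.
  by rewrite ltrBlDl (le_lt_trans aN) // ltrD2l gtr_pMr // invf_lt1 // ltr1n.
rewrite ltrBrDl; case: (ltngtP K N) leKN => // [ltKN | EKN] _; last first.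
  by rewrite /a -EKN big_geq // ltrBlDr (le_lt_trans t1) // ltrDl.
case: N => [//|N] in aN minN ltKN n0 n_rough ratio *.
have := aS N ltKN; have : t + e / 2 < a N.
  rewrite ltNge; apply/negP => aN'.
  by have := minN N; rewrite /Q -ltnS ltKN aN' ltnn => /(_ isT).
by lra.
Qed.

(** * Wreath products with cyclic regular groups *)

(** The number of cycles of [b] divides [n] and is 1 exactly for generators. Otherwise it has a
    prime factor, which is at least [q]. *)
Lemma regular_cyclic_cycle_sum (R : realType) (n q : nat) (c : 'S_n) (x : R) :
  (0 < n)%N -> regular_perm <[c]> ->
  (forall p, prime p -> (p %| n)%N -> (q <= p)%N) -> 0 <= x <= 1 ->
  `|(\sum_(b in <[c]>%g) x ^+ fcard b 'I_n) / #|<[c]>%g|%:R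
    - (totient n)%:R / n%:R * x| <= x ^+ q.
Proof.
move=> n0 reg rough /andP[x0 x1]; have cardC := card_regular_perm n0 reg.
have n0R : 0 < n%:R :> R by rewrite ltr0n.
have oc : #[c]%g = n by rewrite orderE.
have genE b : b \in <[c]>%g -> generator <[c]> b = (fcard b 'I_n == 1%N).
  move=> bC; have E := fcard_regular_perm reg bC.
  rewrite /generator eq_sym eqEcard cycle_subG bC /= cardC -orderE.
  have f0 : (0 < fcard b 'I_n)%N.
    by rewrite lt0n; apply: contraTneq n0 => f0; rewrite -E f0.
  have -> : (n <= #[b]%g)%N = (fcard b 'I_n * #[b]%g <= 1 * #[b]%g)%N.
    by rewrite E mul1n.
  by rewrite leq_pmul2r ?order_gt0 // eqn_leq f0 andbT.
rewrite cardC (bigID (generator <[c]>)) /=.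
rewrite (eq_bigr (fun=> x)); last first.
  by move=> b /andP[bC]; rewrite genE // => /eqP->; rewrite expr1.
rewrite sumr_const.
have -> : #|[pred b | (b \in <[c]>%g) && generator <[c]> b]| = totient n.
  rewrite -[in RHS]oc totient_gen cardsE; apply: eq_card => b; rewrite !inE.
  by apply: andb_idl => /cycle_generator.
rewrite mulrDl -[x *+ _]mulr_natl mulrAC addrAC subrr add0r.
rewrite ger0_norm; last first.
  by rewrite divr_ge0 // sumr_ge0 // => b _; rewrite exprn_ge0.
rewrite ler_pdivrMr //.
apply: (@le_trans _ _ (\sum_(b in <[c]>%g) x ^+ q)); last first.
  by rewrite sumr_const cardC mulr_natr.
rewrite big_mkcondr; apply: ler_sum => b bC; case: ifP => [ngen|_]; last first.
  exact: exprn_ge0.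
apply: ler_wiXn2l => //; rewrite genE // in ngen.
have E := fcard_regular_perm reg bC.
apply: (@leq_trans (pdiv (fcard b 'I_n))).
  apply: rough; last first.
    by rewrite (dvdn_trans (pdiv_dvd _)) //; apply/dvdnP; exists #[b]%g; rewrite mulnC.
  apply: pdiv_prime; rewrite ltn_neqAle eq_sym ngen.
  by rewrite lt0n; apply: contraTneq n0 => f0; rewrite -E f0.
apply: pdiv_leq; rewrite lt0n; apply: contraTneq n0 => f0.
by rewrite -E f0.
Qed.

Lemma derangement_proportion_ge0 (R : realType) (aT : finGroupType)
    (T : finType) (to : {action aT &-> T}) (G : {group aT}) :
  0 <= derangement_proportion R to G.
Proof. exact: divr_ge0. Qed.

Lemma derangement_proportion_le1 (R : realType) (aT : finGroupType)
    (T : finType) (to : {action aT &-> T}) (G : {group aT}) :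
  derangement_proportion R to G <= 1.
Proof. by rewrite derangement_proportionE gerBl divr_ge0. Qed.

Lemma fcard_perm_gt0 (n : nat) (b : 'S_n) : (0 < n)%N -> (0 < fcard b 'I_n)%N.
Proof.
move=> n0; apply/card_gt0P; exists (froot b (Ordinal n0)).
by rewrite !inE andbT (roots_root (fconnect_sym (@perm_inj _ b))).
Qed.

(** Every [b] has at least one cycle, so [x ^ c(b) <= x]. *)
Lemma derangement_proportion_power_ge (R : realType) (m n : nat)
    (A : {group 'S_m}) (B : {group 'S_n}) : (0 < n)%N ->
  derangement_proportion R 'P A <=
  derangement_proportion R (power_action m n) (wreath_group A B).
Proof.
move=> n0; rewrite derangement_proportion_power.
set d := derangement_proportion R 'P A; rewrite lerBrDr -lerBrDl.
rewrite ler_pdivrMr ?ltr0n ?cardG_gt0 //.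
apply: (@le_trans _ _ (\sum_(b in B) (1 - d))); last first.
  by rewrite sumr_const mulr_natr.
apply: ler_sum => b _; rewrite -[leRHS]expr1.
apply: ler_wiXn2l; rewrite ?fcard_perm_gt0 ?subr_ge0 ?gerBl //.
  exact: derangement_proportion_le1.
exact: derangement_proportion_ge0.
Qed.

(** Positivity of delta(A) gives [x < 1], so that the error [x ^ q] can be made small. If delta(A)
    were 0, all the proportions would be 0. *)
Lemma regular_wreath_dense (R : realType) (m : nat) (A : {group 'S_m})
    (t e : R) :
  0 < derangement_proportion R 'P A ->
  derangement_proportion R 'P A <= t <= 1 -> 0 < e ->
  exists n (B : {group 'S_n}), [/\ (0 < n)%N, regular_perm B &
    `|derangement_proportion R (power_action m n) (wreath_group A B) - t| < e].
Proof.
set d := derangement_proportion R 'P A => d0 /andP[dt t1] e0.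
have d1 : d <= 1 by exact: derangement_proportion_le1.
pose x := 1 - d; have x0 : 0 <= x by rewrite subr_ge0.
have x1 : x < 1 by rewrite gtrBl.
(* The ratio phi(n) / n to aim for. If [x = 0], then [t = 1] and [s] is 0 by the convention for
   division by 0. *)
pose s := (1 - t) / x.
have sx : s * x = 1 - t.
  have [xE|xN] := eqVneq x 0; last by rewrite /s divfK.
  rewrite xE mulr0; apply/eqP; rewrite eq_sym subr_eq0 eq_le t1.
  by rewrite (le_trans _ dt) // -subr_le0 -/x xE.
have s01 : 0 <= s <= 1.
  apply/andP; split; first by rewrite divr_ge0 // subr_ge0.
  have [xE|xN] := eqVneq x 0; first by rewrite /s xE invr0 mulr0.
  by rewrite ler_pdivrMr ?lt0r ?xN // mul1r lerD2l lerN2.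
have [q xq] : exists q, x ^+ q < e / 2.
  have : `|x| < 1 by rewrite ger0_norm.
  move=> /cvg_expr/cvgrPdist_lt/(_ (e / 2)) [|N _ /(_ N (leqnn N))].
    by rewrite divr_gt0.
  by move=> /=; rewrite sub0r normrN ger0_norm ?exprn_ge0 //; exists N.
have [n [n0 rough tot]] := totient_ratio_dense q s01 (divr_gt0 e0 (ltr0Sn R 1)).
have [c reg] := exists_regular_cyclic n0.
exists n, <[c]>%G; split => //.
have x01 : 0 <= x <= 1 by rewrite x0 ltW.
have := regular_cyclic_cycle_sum n0 reg rough x01.
rewrite derangement_proportion_power -/d -/x.
set S := (\sum_(b in _) _) / _; set r := (_ / _) in tot *.
rewrite distrC => HS.
have -> : 1 - S - t = (r * x - S) - (r - s) * x by rewrite mulrBl sx; ring.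
apply: le_lt_trans (ler_normB _ _) _; rewrite [ltRHS]splitr; apply: ltr_leD.
  exact: le_lt_trans HS xq.
rewrite normrM [`|x|]ger0_norm //; apply: le_trans (ltW tot).
by rewrite ler_piMr // ltW.
Qed.

(** * The affine group of a finite field *)

Definition affine_set (F : finFieldType) : {set {perm F}} :=
  [set s : {perm F} | [exists u : F * F,
     (u.1 != 0) && [forall x, s x == u.1 * x + u.2]]].

Lemma affineP (F : finFieldType) (s : {perm F}) :
  reflect (exists a b, a != 0 /\ forall x, s x = a * x + b) (s \in affine_set F).
Proof.
rewrite inE; apply: (iffP existsP) => [[[a b] /andP[a0 /forallP H]]|[a [b [a0 H]]]].
  by exists a, b; split => // x; apply/eqP.
by exists (a, b); rewrite a0; apply/forallP => x; rewrite H.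
Qed.

Lemma affine_group_set (F : finFieldType) : group_set (affine_set F).
Proof.
apply/group_setP; split.
  apply/affineP; exists 1, 0; split; first exact: oner_neq0.
  by move=> x; rewrite perm1 mul1r addr0.
move=> s s' /affineP[a [b [a0 H]]] /affineP[a' [b' [a'0 H']]].
apply/affineP; exists (a' * a), (a' * b + b'); split; first by rewrite mulf_neq0.
by move=> x; rewrite permM H H' mulrDr mulrA addrA.
Qed.

Canonical affine_group (F : finFieldType) := Group (affine_group_set F).

Lemma mem_affine (F : finFieldType) (a b : F) : a != 0 ->
  exists2 s, s \in affine_set F & forall x, s x = a * x + b.
Proof.
move=> a0; have inj : injective (fun x => a * x + b).
  by move=> x y /addIr /(mulfI a0).
exists (perm inj) => [|x]; last by rewrite permE.
by apply/affineP; exists a, b; split => // x; rewrite permE.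
Qed.

Lemma affine_two_transitive (F : finFieldType) : two_transitive (affine_set F).
Proof.
move=> x y x' y' neq neq'.
have d : x - y != 0 by rewrite subr_eq0.
have a0 : (x' - y') / (x - y) != 0.
  by rewrite mulf_neq0 ?invr_eq0 // subr_eq0.
have [s sA sE] := mem_affine (x' - (x' - y') / (x - y) * x) a0.
exists s => //; rewrite !sE; split; first by rewrite addrC subrK.
rewrite addrCA -mulrBr -(opprB x y) mulrN divfK // opprB addrC subrK.
by [].
Qed.

Lemma affine_derangement_gt0 (R : realType) (F : finFieldType) :
  0 < derangement_proportion R ('P : {action {perm F} &-> F}) (affine_group F).
Proof.
rewrite divr_gt0 // ltr0n ?cardG_gt0 //; apply/card_gt0P.
have [s sA sE] := mem_affine 1 (oner_neq0 F).
exists s; rewrite inE sA; apply/forallP => x /=.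
by rewrite apermE sE mul1r -subr_eq0 addrAC subrr add0r oner_neq0.
Qed.

(** By two-transitivity, [(s 0, s 1 - s 0)] takes every value with nonzero second component. *)
Lemma card_affine_ge (F : finFieldType) : (#|F| * #|F|.-1 <= #|affine_group F|)%N.
Proof.
pose f (s : {perm F}) := (s 0, s 1 - s 0).
have <- : #|finset.setX [set: F] [set~ (0 : F)]| = (#|F| * #|F|.-1)%N.
  by rewrite cardsX cardsT cardsC1.
apply: leq_trans (leq_imset_card f _); apply: subset_leq_card.
apply/fintype.subsetP => -[x d]; rewrite !inE /= => d0.
have [||s sA [s0 s1]] := @affine_two_transitive F 0 1 x (x + d).
- by rewrite eq_sym oner_neq0.
- by rewrite eq_sym -subr_eq0 addrAC subrr add0r.
by apply/imsetP; exists s => //; rewrite /f s0 s1 addrAC subrr add0r.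
Qed.

(** A map [a * x + b] with [a != 1] fixes [b / (1 - a)]. The derangements are thus translations,
    determined by their value at 0. *)
Lemma affine_derangement_le (R : realType) (F : finFieldType) :
  derangement_proportion R ('P : {action {perm F} &-> F}) (affine_group F)
    <= (#|F|.-1)%:R^-1.
Proof.
have F1 := card_finNzRing_gt1 F.
have F10 : (0 < #|F|.-1)%N by rewrite -ltnS prednK // ltnW.
rewrite /derangement_proportion ler_pdivrMr ?ltr0n ?cardG_gt0 //.
rewrite mulrC ler_pdivlMr ?ltr0n // -natrM ler_nat.
apply: leq_trans (card_affine_ge F); rewrite leq_mul2r; apply/orP; right.
pose f (s : {perm F}) := s 0.
rewrite -(@card_in_imset _ _ f); first exact: max_card.
have trans s : s \in [set g in affine_group F | [forall x, 'P%act x g != x]] ->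
    forall x, s x = x + s 0.
  rewrite inE => /andP[/affineP[a [b [a0 sE]]] /forallP nfix] x.
  have [a1|a1] := eqVneq a 1; first by rewrite !sE a1 mulr0 !mul1r add0r.
  have := nfix (b / (1 - a)); rewrite /= apermE sE => /negP[]; apply/eqP.
  have n1 : 1 - a != 0 by rewrite subr_eq0 eq_sym.
  by field.
move=> s s' /trans sE /trans s'E E; apply/permP => x.
by rewrite sE s'E; congr (_ + _).
Qed.

(** * Density *)

Lemma primitive_derangement_dense (R : realType) (s e : R) :
  0 <= s <= 1 -> 0 < e ->
  exists m (A : {group 'S_m}), [/\ (0 < m)%N, primitive_perm A &
    `|derangement_proportion R 'P A - s| < e].
Proof.
move=> /andP[s0 s1] e0.
have [p ltp pr_p] := prime_above ((Num.truncn (2 / e)).+3).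
have p3 : (2 < p)%N by exact: leq_trans ltp.
(* ['F_p] is by definition the ordinal type ['I_m], so its affine group is already a subgroup of
   ['S_m]. *)
pose m := (Zp_trunc (pdiv p)).+2.
have mE : m = p by rewrite -[RHS](card_Fp pr_p) card_ord.
pose A : {group 'S_m} := affine_group 'F_p.
pose d : R := derangement_proportion R 'P A.
have d0 : 0 < d := affine_derangement_gt0 R 'F_p.
have de : d < e / 2.
  apply: le_lt_trans (affine_derangement_le R 'F_p) _.
  rewrite card_Fp // -[ltRHS]invrK ltf_pV2 ?posrE ?invr_gt0 ?divr_gt0 //.
    rewrite invf_div; apply: lt_le_trans (truncnS_gt _) _.
    by rewrite ler_nat -ltnS prednK ?prime_gt0 //; do 2!apply: ltnW.
  by rewrite ltr0n -ltnS prednK ?prime_gt1 ?prime_gt0.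
(* Only targets in [d, 1] can be reached from [A]; raising [s] to [d] when necessary costs less than
   [e / 2]. *)
have dt : d <= Num.max s d <= 1.
  by rewrite le_max lexx orbT ge_max s1 derangement_proportion_le1.
have [n [B [n0 regB HB]]] := regular_wreath_dense d0 dt (divr_gt0 e0 (ltr0Sn R 1)).
have m3 : (2 < m)%N by rewrite mE.
have trA : two_transitive A := @affine_two_transitive 'F_p.
have /andP[trB _] := regB.
have [A' [primA' dA']] := perm_group_of_action R
  (power_transitive B trA m3) (power_no_invariant_rel trA m3 trB).
exists _, A'; split => //.
  by apply/card_gt0P; exists [ffun=> Ordinal (ltnW (ltnW m3))].
rewrite dA'; set w := derangement_proportion _ _ _ in HB *.
have -> : w - s = (w - Num.max s d) + (Num.max s d - s) by ring.
apply: le_lt_trans (ler_normD _ _) _; rewrite [ltRHS]splitr; apply: ltrD => //.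
by case: (leP s d) => sd; rewrite ?subrr ?normr0 ?divr_gt0 // ger0_norm ?subr_ge0 //; lra.
Qed.

Lemma primitive_wreath_dense (R : realType) (n : nat) (B : {group 'S_n})
    (t e : R) :
  (0 < n)%N -> 0 <= t <= 1 -> 0 < e ->
  exists m (A : {group 'S_m}), [/\ (0 < m)%N, primitive_perm A &
    `|derangement_proportion R (power_action m n) (wreath_group A B) - t| < e].
Proof.
move=> n0 /andP[t0 t1] e0.
(* delta(A wr_P B) as a polynomial in delta(A). The intermediate value theorem gives [s] with
   [Q(s) = t], and continuity at [s] allows delta(A) to be merely close to [s]. *)
pose Q : {poly R} :=
  1 - (#|B|%:R^-1)%:P * \sum_(b in B) (1 - 'X) ^+ fcard b 'I_n.
have B0 : #|B|%:R != 0 :> R by rewrite pnatr_eq0 -lt0n cardG_gt0.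
have QE m (A : {group 'S_m}) :
    derangement_proportion R (power_action m n) (wreath_group A B) =
    Q.[derangement_proportion R 'P A].
  rewrite derangement_proportion_power !hornerE horner_sum mulrC.
  by congr (1 - _ * _); apply: eq_bigr => b _; rewrite !hornerE.
have Q0 : Q.[0] = 0.
  rewrite !hornerE horner_sum (eq_bigr (fun=> 1)) => [|b _]; last first.
    by rewrite !hornerE subr0 expr1n.
  by rewrite sumr_const mulVf ?subrr.
have Q1 : Q.[1] = 1.
  rewrite !hornerE horner_sum big1 ?mulr0 ?subr0 // => b _.
  by rewrite !hornerE subrr expr0n gtn_eqF ?fcard_perm_gt0.
have [||s s01 /rootP] := @poly_ivt R (Q - t%:P) 0 1 => //.
  rewrite ![(Q - _).[_]]hornerD ![(- _).[_]]hornerN !hornerC.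
  by rewrite Q0 Q1 sub0r oppr_le0 t0 subr_ge0.
rewrite hornerD hornerN hornerC => /eqP; rewrite subr_eq0 => /eqP Qs.
have /cvgrPdist_lt/(_ e e0) := @continuous_horner R Q s.
move=> /nbhs_ballP[d /= d0 Hd].
have [m [A [m0 primA HA]]] := primitive_derangement_dense s01 d0.
exists m, A; split => //; rewrite QE -Qs distrC; apply: Hd.
by rewrite /ball /= distrC.
Qed.

Local Open Scope classical_set_scope.

Lemma closure_normP (R : realType) (D : set R) (t : R) :
  (forall e, 0 < e -> exists2 x, D x & `|x - t| < e) -> closure D t.
Proof.
move=> H U /nbhs_ballP[e e0 sU]; have [x Dx xt] := H e e0.
by exists x; split => //; apply: sU; rewrite /ball /= distrC.
Qed.

Theorem theorem1p3 (R : realType) :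
  (forall (n : nat) (B : {group 'S_n}), (0 < n)%N ->
     dense_in
       [set x : R | exists (m : nat) (A : {group 'S_m}),
          [/\ (0 < m)%N, primitive_perm A &
              x = derangement_proportion R (power_action m n)
                    (wreath_group A B)]]
       `[0, 1]) /\
  (forall (m : nat) (A : {group 'S_m}), (0 < m)%N ->
     0 < derangement_proportion R ('P : {action 'S_m &-> 'I_m}) A ->
     dense_in
       [set x : R | exists (n : nat) (B : {group 'S_n}),
          [/\ (0 < n)%N, regular_perm B &
              x = derangement_proportion R (power_action m n)
                    (wreath_group A B)]]
       `[derangement_proportion R ('P : {action 'S_m &-> 'I_m}) A, 1]).
Proof.
split=> [n B n0 | m A m0 d0]; split.
- move=> _ [m [A [_ _ ->]]] /=; rewrite in_itv /=.
  by rewrite derangement_proportion_ge0 derangement_proportion_le1.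
- move=> t /=; rewrite in_itv /= => t01; apply: closure_normP => e e0.
  have [m [A [m0 primA H]]] := primitive_wreath_dense B n0 t01 e0.
  by eexists; [exists m, A; split | exact: H].
- move=> _ [n [B [n0 _ ->]]] /=; rewrite in_itv /=.
  by rewrite derangement_proportion_power_ge // derangement_proportion_le1.
- move=> t /=; rewrite in_itv /= => t01; apply: closure_normP => e e0.
  have [n [B [n0 regB H]]] := regular_wreath_dense d0 t01 e0.
  by eexists; [exists n, B; split | exact: H].
Qed.
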